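(* Let $k\ge1$ and let $g\ge k+1$ be integers. Then $W_{k,1}(g,3g-k-3)>0$.
   Context: For an integer $m\ge 0$, $p_m(X,Z)=\operatorname{Res}_{t=0}\frac{dt}{t^{m+1}}(1+t)^{Z-2X}(1+2t)^X$, i.e. the coefficient of $t^m$ in $(1+t)^{Z-2X}(1+2t)^X$, a polynomial in $X,Z$. For $h\ge0$, $$W_{k,h}(X,Z)=\det\bigl(p_{k+h}(X-h+i,Z+j)\bigr)_{0\le i\le h}^{0\le j\le h},$$ so that $W_{k,1}(X,Z)=p_{k+1}(X-1,Z)\,p_{k+1}(X,Z+1)-p_{k+1}(X-1,Z+1)\,p_{k+1}(X,Z)$. *)

(* Defs.v *)
From mathcomp Require Import all_boot all_order all_algebra.

Set Implicit Arguments.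
Unset Strict Implicit.
Unset Printing Implicit Defensive.

Import Order.TTheory GRing.Theory Num.Theory.
Local Open Scope ring_scope.

(* Generalized binomial coefficient a (a - 1) ... (a - n + 1) / n!; the upper
   argument may be negative. *)
Definition gbinom (a : rat) (n : nat) : rat :=
  (\prod_(i < n) (a - i%:R)) / (n`!)%:R.

(* Formal power series in t are represented by their coefficient sequences. *)
Definition binom_series (c a : rat) : nat -> rat :=
  fun n => gbinom a n * c ^+ n.  (* (1 + c t)^a *)

Definition mul_series (u v : nat -> rat) : nat -> rat :=
  fun n => \sum_(i < n.+1) u i * v (n - i)%N.

(* The residue at t = 0 of f(t) dt / t^(m+1) is the coefficient of t^m in f. *)
Definition p (m : nat) (X Z : rat) : rat :=
  mul_series (binom_series 1 (Z - 2 * X)) (binom_series 2 X) m.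

Definition W (k h : nat) (X Z : rat) : rat :=
  \det (\matrix_(i < h.+1, j < h.+1)
          p (k + h) (X - h%:R + (i : nat)%:R) (Z + (j : nat)%:R)).

Lemma gbinom_nat (a n : nat) : gbinom a%:R n = 'C(a, n)%:R.
Proof.
rewrite /gbinom; have nz : (n`!)%:R != 0 :> rat by rewrite pnatr_eq0 -lt0n fact_gt0.
apply: (mulIf nz); rewrite divfK // -natrM bin_ffact.
elim: n {nz} => [|n IHn]; first by rewrite big_ord0.
rewrite big_ord_recr /= IHn ffactnSr natrM.
case: (leqP n a) => [le_na|lt_an]; first by rewrite natrB.
by rewrite ffact_small // !mul0r.
Qed.

Lemma coef_binom_series (c : rat) (a n : nat) :
  binom_series c a%:R n = ((1 + c *: 'X) ^+ a)`_n.
Proof.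
rewrite /binom_series gbinom_nat exprDn coef_sum.
under eq_bigr => i _ do
  rewrite expr1n mul1r coefMn exprZn coefZ coefXn.
have [lt_na|le_an] := ltnP n a.+1.
  rewrite (bigD1 (Ordinal lt_na)) //= eqxx mulr1 mulr_natl big1 ?addr0 // => i ne_i.
  suff ->: (n == i :> nat) = false by rewrite mulr0 mul0rn.
  by apply: contraNF ne_i => /eqP def_n; apply/eqP/val_inj; rewrite /= def_n.
rewrite bin_small // mul0r big1 // => i _.
by rewrite gtn_eqF ?mulr0 ?mul0rn // (leq_trans (ltn_ord i)).
Qed.

(* For natural exponents, p is a coefficient of an actual polynomial in t; as
   p m X Z is polynomial in X and Z, these values determine it. *)
Lemma p_nat (m x y : nat) :
  p m x%:R (y + 2 * x)%:R = ((1 + 'X) ^+ y * (1 + 2 *: 'X) ^+ x)`_m.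
Proof.
rewrite /p natrD natrM addrK coefM /mul_series.
by apply: eq_bigr => i _; rewrite !coef_binom_series scale1r.
Qed.

Lemma W1E (k : nat) (X Z : rat) :
  W k 1 X Z = p k.+1 (X - 1) Z * p k.+1 X (Z + 1)
            - p k.+1 (X - 1) (Z + 1) * p k.+1 X Z.
Proof.
rewrite /W (expand_det_row _ ord0) !big_ord_recl big_ord0 /cofactor !det_mx11.
by rewrite !mxE /= /bump /= addn1 !addr0 subrK add0n addn0 expr0 expr1 mul1r mulN1r mulrN.
Qed.

(* Main.v *)
(* Write n = k + 1 and a = g - n.  The substitution t = s / (1 - s) turns the
   coefficient of t^m in (1+t)^(m - f + 2a) (1+2t)^f into the coefficient G_m
   of s^m in (1+s)^f / (1-s)^(2a+1).  For f = n + a - 1 the four entries of the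
   determinant are linear combinations of G_n, ..., G_(n-3), and it collapses to
   G_(n-1) G_(n-2) - G_n G_(n-3).  Log-concavity of 1 / (1-s)^(2a+1) is preserved
   under multiplication by 1+s, which moreover propagates strictness from
   indices (i, j) to (i+1, j+1); the strict inequality at i = 0 is free. *)
Require Import Defs.
From mathcomp Require Import all_boot all_order all_algebra.
From mathcomp Require Import ring lra zify.

Import Order.TTheory GRing.Theory Num.Theory.
Local Open Scope ring_scope.

Lemma gbinom0 (a : rat) : gbinom a 0 = 1.
Proof. by rewrite /gbinom big_ord0 fact0 divr1. Qed.

(** Pascal's rule for a rational upper argument: all three terms are multiples of
    [a (a - 1) ... (a - n + 1)]. *)
Lemma gbinomS (a : rat) (n : nat) :
  gbinom (a + 1) n.+1 = gbinom a n.+1 + gbinom a n.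
Proof.
rewrite /gbinom big_ord_recl [X in _ = X / _ + _]big_ord_recr /=.
rewrite (eq_bigr (fun i : 'I_n => a - i%:R)); last first.
  by move=> i _; rewrite /bump add1n -natr1; ring.
rewrite factS natrM -[n.+1%:R]natr1.
have nz : (n`!)%:R != 0 :> rat by rewrite pnatr_eq0 -lt0n fact_gt0.
have nz1 : n%:R + 1 != 0 :> rat by rewrite natr1 pnatr_eq0.
by field; rewrite nz nz1.
Qed.

(* Indices are shifted by one, so that the value 0 at index 0 stands for the
   coefficient of t^(-1). *)
Definition coef_shift (e f : rat) (i : nat) : rat :=
  if i is m.+1 then mul_series (binom_series 1 e) (binom_series 2 f) m else 0.

Lemma coef_shift1 (e f : rat) : coef_shift e f 1 = 1.
Proof.
by rewrite /= /mul_series big_ord1 subnn /binom_series !gbinom0 !expr0 !mulr1.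
Qed.

Lemma binom_seriesS (c a : rat) (n : nat) :
  binom_series c (a + 1) n.+1 = binom_series c a n.+1 + c * binom_series c a n.
Proof. by rewrite /binom_series gbinomS exprS; ring. Qed.

Lemma binom_series0 (c a : rat) : binom_series c a 0 = 1.
Proof. by rewrite /binom_series gbinom0 expr0 mulr1. Qed.

Lemma coef_shiftDl (e f : rat) (i : nat) :
  coef_shift (e + 1) f i.+1 = coef_shift e f i.+1 + coef_shift e f i.
Proof.
case: i => [|m]; first by rewrite !coef_shift1 addr0.
rewrite /= /mul_series big_ord_recl [X in _ = X + _]big_ord_recl !binom_series0.
rewrite -addrA; congr (_ + _); rewrite -big_split /=.
apply: eq_bigr => i _.
by rewrite /bump add1n subSS binom_seriesS mul1r mulrDl.
Qed.

Lemma coef_shiftDr (e f : rat) (i : nat) :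
  coef_shift e (f + 1) i.+1 = coef_shift e f i.+1 + 2 * coef_shift e f i.
Proof.
case: i => [|m]; first by rewrite !coef_shift1 mulr0 addr0.
rewrite /= /mul_series big_ord_recr [X in _ = X + _]big_ord_recr /=.
rewrite !subnn !binom_series0 addrAC; congr (_ + _).
rewrite mulr_sumr -big_split /=; apply: eq_bigr => i _.
by rewrite subSn -1?ltnS // binom_seriesS; ring.
Qed.

Lemma coef_shift_f0 (e : rat) (m : nat) : coef_shift e 0 m.+1 = gbinom e m.
Proof.
rewrite /= /mul_series big_ord_recr /= subnn binom_series0 big1 => [|i _].
  by rewrite add0r /binom_series expr1n !mulr1.
rewrite -[(m - i)%N]prednK ?subn_gt0 // /binom_series /gbinom big_ord_recl.
by rewrite subrr !mul0r mulr0.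
Qed.

(** The ratios [x i.+1 / x i] decrease, stated without division since [x 0] may vanish. *)
Definition log_concave (x : nat -> rat) : Prop :=
  forall i j : nat, (i <= j)%N -> x i * x j.+1 <= x i.+1 * x j.

Section PascalStep.

Variables x y : nat -> rat.
Hypotheses (y0 : y 0%N = 0) (yS : forall i, y i.+1 = x i.+1 + x i).
Hypothesis lcx : log_concave x.

(** The right-hand side expands into three minors of [x]: the left-hand side, the one at
    [i.+1, j.+1], and [x i.+2 * x j - x i * x j.+2]. The last two are nonnegative. *)
Lemma pascal_minor (i j : nat) : (i <= j)%N ->
  x i.+1 * x j - x i * x j.+1 <= y i.+2 * y j.+1 - y i.+1 * y j.+2.
Proof.
move=> le_ij; rewrite !yS.
have le1 := @lcx i.+1 j.+1 le_ij.
suff le2 : x i * x j.+2 <= x i.+2 * x j by lra.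
move: le_ij; rewrite leq_eqVlt => /predU1P[-> | lt_ij]; first by rewrite mulrC.
(* The chain passes through [x i.+1 * x j.+1]. *)
by apply: le_trans (@lcx i j.+1 _) (@lcx i.+1 j lt_ij); rewrite ltnW // ltnS ltnW.
Qed.

Lemma log_concave_pascal : (forall i, 0 <= y i) -> log_concave y.
Proof.
move=> y_ge0 [|i] [|j] // le_ij; first by rewrite mulrC.
  by rewrite y0 mul0r mulr_ge0.
by have := pascal_minor i j le_ij; have := @lcx i j le_ij; lra.
Qed.

End PascalStep.

(* The coefficient of s^(i-1) in (1+s)^f / (1-s)^(2a+1). *)
Definition lc_seq (a f i : nat) : rat :=
  coef_shift (i%:R - f%:R + (2 * a%:R - 1)) f%:R i.

Lemma lc_seq0 (a f : nat) : lc_seq a f 0 = 0.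
Proof. by []. Qed.

Lemma lc_seq_base (a i : nat) : lc_seq a 0 i.+1 = 'C(i + a.*2, i)%:R.
Proof.
rewrite /lc_seq coef_shift_f0 -gbinom_nat; congr gbinom.
by rewrite natrD -mul2n natrM -natr1; ring.
Qed.

(** This is multiplication by [1 + s = (1 + 2t) / (1 + t)]; in terms of [t] it reads
    [1 + 2t = (1 + t) + t]. *)
Lemma lc_seq_pascal (a f i : nat) :
  lc_seq a f.+1 i.+1 = lc_seq a f i.+1 + lc_seq a f i.
Proof.
rewrite /lc_seq -![_.+1%:R]natr1.
set e := i%:R - f%:R + (2 * a%:R - 1) : rat.
have -> : i%:R + 1 - (f%:R + 1) + (2 * a%:R - 1) = e by rewrite /e; ring.
have -> : i%:R + 1 - f%:R + (2 * a%:R - 1) = e + 1 by rewrite /e; ring.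
by rewrite coef_shiftDl coef_shiftDr; ring.
Qed.

Lemma lc_seq_gt0 (a f i : nat) : 0 < lc_seq a f i.+1.
Proof.
elim: f i => [|f IHf] i; first by rewrite lc_seq_base ltr0n bin_gt0 leq_addr.
rewrite lc_seq_pascal; case: i => [|i]; first by rewrite lc_seq0 addr0.
by rewrite addr_gt0.
Qed.

Lemma lc_seq_ge0 (a f i : nat) : 0 <= lc_seq a f i.
Proof. by case: i => [|i]; rewrite ?lc_seq0 // ltW ?lc_seq_gt0. Qed.

Lemma lc_seq_baseS (a i : nat) :
  i.+1%:R * lc_seq a 0 i.+2 = (i + a.*2).+1%:R * lc_seq a 0 i.+1.
Proof. by rewrite !lc_seq_base -!natrM addSn mul_bin_diag. Qed.

Lemma log_concave_lc_seq (a f : nat) : log_concave (lc_seq a f).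
Proof.
elim: f => [|f IHf]; last first.
  exact: (log_concave_pascal _ _ (lc_seq0 a f.+1) (lc_seq_pascal a f) IHf
            (lc_seq_ge0 a f.+1)).
move=> [|i] [|j] // le_ij; first by rewrite mulrC.
  by rewrite lc_seq0 mul0r mulr_ge0 ?lc_seq_ge0.
(* Scaling by [i.+1] and [j.+1] clears the denominators of the consecutive ratios; what remains
   amounts to [2 a i <= 2 a j]. *)
rewrite -(ler_pM2l (ltr0Sn _ i)) -(ler_pM2l (ltr0Sn _ j)).
set xi := lc_seq a 0 i.+1; set xj := lc_seq a 0 j.+1.
have -> : j.+1%:R * (i.+1%:R * (xi * lc_seq a 0 j.+2)) =
    (i.+1 * (j + a.*2).+1)%:R * (xi * xj).
  rewrite [LHS](_ : _ = i.+1%:R * xi * (j.+1%:R * lc_seq a 0 j.+2)); last by ring.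
  by rewrite lc_seq_baseS -/xj natrM; ring.
have -> : j.+1%:R * (i.+1%:R * (lc_seq a 0 i.+2 * xj)) =
    (j.+1 * (i + a.*2).+1)%:R * (xi * xj).
  rewrite [LHS](_ : _ = j.+1%:R * xj * (i.+1%:R * lc_seq a 0 i.+2)); last by ring.
  by rewrite lc_seq_baseS -/xi natrM; ring.
rewrite ler_wpM2r ?mulr_ge0 ?lc_seq_ge0 // ler_nat.
by nia.
Qed.

(** Each induction step spends one factor [1 + s], and [i <= f] provides enough of them. For
    [a = f = 0] the sequence is constant from index 1 on, so strictness has to start from the value
    0 at index 0. *)
Lemma lc_seq_strict (a f i j : nat) : (i <= f)%N -> (i < j)%N ->
  lc_seq a f i * lc_seq a f j.+1 < lc_seq a f i.+1 * lc_seq a f j.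
Proof.
elim: i f j => [|i IHi] f [|j] // le_if lt_ij.
  by rewrite lc_seq0 mul0r mulr_gt0 ?lc_seq_gt0.
case: f le_if => // f le_if.
have := pascal_minor _ _ (lc_seq_pascal a f) (log_concave_lc_seq a f) i j
            (ltnW (lt_ij : (i < j)%N)).
by have := IHi f j le_if lt_ij; lra.
Qed.

Lemma W1_lc_seq (k a : nat) (g := (a + k.+2)%N) :
  W k.+1 1 g%:R (3 * g%:R - k.+1%:R - 3) =
    lc_seq a g.-1 k.+1 * lc_seq a g.-1 k.+2
    - lc_seq a g.-1 k * lc_seq a g.-1 k.+3.
Proof.
have pE m X Z : p m X Z = coef_shift (Z - 2 * X) X m.+1 by [].
rewrite W1E !pE /lc_seq.
(* [e] is the exponent of [1 + t] in [lc_seq a g.-1 k]; the other factors have exponents up to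
   [e + 3]. *)
set f : rat := g.-1%:R; set e : rat := a%:R - 2.
have gE : g%:R = f + 1 by rewrite /f natr1 /g addnS.
have fE : f = a%:R + k%:R + 1 by rewrite /f /g addnS natrD -natr1 addrA.
rewrite gE -![_.+1%:R]natr1 addrK.
have -> : 3 * (f + 1) - (k%:R + 1) - 3 - 2 * f = e + 1 + 1 by rewrite /e fE; ring.
have -> : 3 * (f + 1) - (k%:R + 1) - 3 + 1 - 2 * f = e + 1 + 1 + 1.
  by rewrite /e fE; ring.
have -> : 3 * (f + 1) - (k%:R + 1) - 3 + 1 - 2 * (f + 1) = e + 1.
  by rewrite /e fE; ring.
have -> : 3 * (f + 1) - (k%:R + 1) - 3 - 2 * (f + 1) = e by rewrite /e fE; ring.
have -> : k%:R - f + (2 * a%:R - 1) = e by rewrite /e fE; ring.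
have -> : k%:R + 1 - f + (2 * a%:R - 1) = e + 1 by rewrite /e fE; ring.
have -> : k%:R + 1 + 1 - f + (2 * a%:R - 1) = e + 1 + 1 by rewrite /e fE; ring.
have -> : k%:R + 1 + 1 + 1 - f + (2 * a%:R - 1) = e + 1 + 1 + 1.
  by rewrite /e fE; ring.
(* Every factor reduces to coefficients of [(1+t)^e (1+2t)^f] at the shifted indices [k] to
   [k.+3]. *)
rewrite !(coef_shiftDl, coef_shiftDr).
ring.
Qed.

Theorem proposition4p13 (k g : nat) (hk : (1 <= k)%N) (hg : (k + 1 <= g)%N) :
  0 < W k 1 g%:R (3 * g%:R - k%:R - 3).
Proof.
case: k hk hg => // k _ le_kg.
(* Here [k] is one less than in the statement, and [a] is [g - k.+2]. *)
have -> : g = (g - k.+2 + k.+2)%N by rewrite subnK // -addn1.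
rewrite W1_lc_seq subr_gt0 lc_seq_strict //.
by rewrite addnS (leq_trans (leqnSn k)) ?leq_addl.
Qed.
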